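(* Let $(X,\mathcal{B}_X,\mu,T)$ be a $\mathbb{Z}^2$-MPS. Then the following statements are equivalent. (a) There exist two directions $\vec{v}=(1,\beta_1)$, $\vec{w}=(1,\beta_2)\in\mathbb{R}^2$ with $\beta_1\neq\beta_2$ such that $\mu$ has $\vec{v}$-discrete spectrum and $\vec{w}$-discrete spectrum. (b) $\mu$ has discrete spectrum.
   Context: A $\mathbb{Z}^2$-measure preserving dynamical system ($\mathbb{Z}^2$-MPS) is a quadruple $(X,\mathcal{B}_X,\mu,T)$ where $X$ is a compact metric space, $\mathcal{B}_X$ its Borel $\sigma$-algebra, $T$ assigns to each $\vec{w}\in\mathbb{Z}^2$ a homeomorphism $T^{\vec{w}}:X\to X$ with $T^{\vec{w}}\circ T^{\vec{u}}=T^{\vec{w}+\vec{u}}$ and $T^{\vec{0}}=\mathrm{id}_X$, and $\mu$ is a Borel probability measure on $X$ invariant under every $T^{\vec{w}}$. Let $U_T^{(m,n)}f=f\circ T^{(m,n)}$ for $f\in L^2(X,\mathcal{B}_X,\mu)$. For $\vec{v}=(1,\beta)\in\mathbb{R}^2$ and $b>0$ put $\Lambda^{\vec{v}}(b)=\{(m,n)\in\mathbb{Z}^2:\beta m-b/2\leq n\leq \beta m+b/2\}$. The $\vec{v}$-directional Kronecker algebra is $$\mathcal{K}_\mu^{\vec{v}}=\left\{B\in\mathcal{B}_X:\overline{\{U_T^{(m,n)}1_B:(m,n)\in\Lambda^{\vec{v}}(b)\}}\text{ is compact in }L^2(X,\mathcal{B}_X,\mu)\right\};$$ it is a $\sigma$-algebra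 and does not depend on the choice of $b\in(0,\infty)$. $\mu$ has $\vec{v}$-discrete spectrum if $\mathcal{K}_\mu^{\vec{v}}=\mathcal{B}_X$. The (classical) Kronecker algebra $\mathcal{K}_\mu$ consists of all $B\in\mathcal{B}_X$ such that $\overline{\{U_T^{(m,n)}1_B:(m,n)\in\mathbb{Z}^2\}}$ is compact in $L^2(X,\mathcal{B}_X,\mu)$; $\mu$ has discrete spectrum if $\mathcal{K}_\mu=\mathcal{B}_X$. *)

(* Defs.v *)
From HB Require Import structures.
From mathcomp Require Import all_boot all_order all_algebra.
From mathcomp Require Import all_classical all_reals all_analysis.
From mathcomp Require Import measurable_realfun.

Set Implicit Arguments.
Unset Strict Implicit.
Unset Printing Implicit Defensive.
Import Order.TTheory GRing.Theory Num.Theory.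
Import numFieldNormedType.Exports.
Local Open Scope classical_set_scope.
Local Open Scope ring_scope.

(* LspaceType has no topology in the library: equip it with the metric
   ||f - g||_p.  Its elements are classes of real-valued functions modulo a.e.
   equality, so this is a genuine metric. *)
Section Lspace_metric.
Context d (T : measurableType d) (R : realType).
Variable mu : {measure set T -> \bar R}.
Variables (p : \bar R) (p1 : (1 <= p)%E).
Implicit Types f g h : LspaceType mu p1.
Local Open Scope quotient_scope.

HB.instance Definition _ := gen_eqMixin (LspaceType mu p1).
HB.instance Definition _ := gen_choiceMixin (LspaceType mu p1).

Definition Ldist f g : R := fine ('N[mu]_p[EFin \o ((f : T -> R) \- (g : T -> R))%R])%E.

Lemma Lspace_mfun f : measurable_fun [set: T] (f : T -> R).
Proof. exact: (@measurable_funPT _ _ _ _ (repr (f : {mfun_ mu, T >-> measurableTypeR R}))). Qed.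

Lemma Lspace_Lfun f : (f : T -> R) \in Lfun mu p.
Proof.
apply/andP; split; rewrite inE /=; first exact: Lspace_mfun.
exact: Lebesgue_finite.
Qed.

Lemma Lspace_eq f g : (f : T -> R) = (g : T -> R) %[ae mu] -> f = g.
Proof.
case: f g => [f [[mf]]] [g [[mg]]] /= fg.
have fgE : f = g.
  rewrite -(reprK f) -(reprK g); apply/eqP.
  by rewrite eqmodE; apply/asboolP.
by subst g; rewrite (Prop_irrelevance mf mg).
Qed.

Lemma Ldist_EFin f g :
  (Ldist f g)%:E = ('N[mu]_p[EFin \o ((f : T -> R) \- (g : T -> R))%R])%E.
Proof.
have fgL : (f : T -> R) \- (g : T -> R) \in Lfun mu p.
  by rewrite rpredB ?Lspace_Lfun.
exact: (@finite_norm_fine _ _ _ mu p p1 (Lfun_Sub p1 fgL)).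
Qed.

Lemma Ldistxx f : Ldist f f = 0.
Proof.
apply: EFin_inj; rewrite Ldist_EFin.
rewrite (_ : _ \o _ = cst 0%E); first by rewrite Lnorm0// gt_eqF// (lt_le_trans _ p1).
by apply/funext => x /=; rewrite subrr.
Qed.

Lemma Ldist_positivity f g : Ldist f g = 0 -> f = g.
Proof.
move=> fg0; apply: Lspace_eq.
have : (EFin \o ((f : T -> R) \- (g : T -> R))%R) = \0%E %[ae mu].
  apply: (@Lnorm_eq0_eq0 _ _ _ mu _ p); last by rewrite -Ldist_EFin fg0.
    by apply/measurable_EFinP; apply: measurable_funB; exact: Lspace_mfun.
  exact: lt_le_trans lte01 p1.
apply: filterS => x /(_ I) /= [] /eqP fgx _; apply/eqP; move: fgx.
by rewrite subr_eq0.
Qed.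

Lemma Ldist_sym f g : Ldist f g = Ldist g f.
Proof.
rewrite /Ldist -oppe_Lnorm; congr (fine (Lnorm _ _ _)).
by apply/funext => x /=; rewrite opprB.
Qed.

Lemma Ldist_triangle g f h : Ldist f h <= Ldist f g + Ldist g h.
Proof.
rewrite -lee_fin EFinD !Ldist_EFin.
rewrite (_ : (f : T -> R) \- (h : T -> R) =
  ((f : T -> R) \- (g : T -> R)) \+ ((g : T -> R) \- (h : T -> R))); last first.
  by apply/funext => x /=; rewrite addrA subrK.
by apply: eminkowski => //; apply: measurable_funB; exact: Lspace_mfun.
Qed.

HB.instance Definition _ := @isMetric.Build R (LspaceType mu p1)
  Ldist Ldistxx Ldist_positivity Ldist_sym Ldist_triangle.

End Lspace_metric.

Section Lclass.
Context d (T : measurableType d) (R : realType).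
Variable mu : {measure set T -> \bar R}.
Variables (r : R) (r1 : (1 <= r%:E)%E).
Local Open Scope quotient_scope.

Section Class.
Variables (f : T -> R) (Lf : f \in Lfun mu r%:E).

Lemma Lclass_measurable : measurable_fun [set: T] (f : T -> measurableTypeR R).
Proof. by move: Lf => /andP[/[!inE]]. Qed.

Definition Lclass_mfun : {mfun T >-> measurableTypeR R} :=
  @mfun_Sub _ _ T (measurableTypeR R) f (mem_set Lclass_measurable).
Definition Lclass_quot : {mfun_ mu, T >-> measurableTypeR R} := \pi Lclass_mfun.

Lemma Lclass_quotE : (Lclass_quot : T -> R) = f %[ae mu].
Proof. by have /eqP := reprK Lclass_quot; rewrite eqmodE => /asboolP. Qed.

Lemma Lclass_finite : finite_norm mu r%:E (Lclass_quot : T -> R).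
Proof.
move: Lf => /andP[_ /[!inE]/=].
rewrite /finite_norm unlock /Lnorm => Nf; apply: le_lt_trans Nf.
have mq : measurable_fun [set: T] (Lclass_quot : T -> R).
  exact: (@measurable_funPT _ _ _ _ (repr Lclass_quot)).
have mpow (g : T -> R) : measurable_fun [set: T] g ->
    measurable_fun [set: T] (fun x => `|(EFin \o g) x| `^ r)%E.
  move=> mg; apply: (measurableT_comp (measurable_poweR r)) => //.
  by apply: measurableT_comp => //; exact/measurable_EFinP.
rewrite le_eqVlt; apply/orP; left; apply/eqP; congr (_ `^ _)%E.
apply: ge0_ae_eq_integral => //.
- exact: mpow.
- by apply: mpow; exact: Lclass_measurable.
- by move=> x _; exact: poweR_ge0.
- by move=> x _; exact: poweR_ge0.
- by apply: filterS Lclass_quotE => x /(_ I) fx _ /=; rewrite fx.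
Qed.

HB.instance Definition _ :=
  @isFinLebesgue.Build d T R mu r%:E r1 Lclass_quot Lclass_finite.

Definition Lclass : LspaceType mu r1 := Lclass_quot.

Lemma LclassE : (Lclass : T -> R) = f %[ae mu].
Proof. exact: Lclass_quotE. Qed.

End Class.
End Lclass.

(* Measurable types are pointed in the library; a probability space is nonempty
   anyway. *)
#[short(type="pointedMetricType")]
HB.structure Definition PointedMetric (K : numDomainType) :=
  {M of Metric K M & Pointed M}.

Definition Borel (X : ptopologicalType) := g_sigma_algebraType (@open X).

Definition homeomorphism (X Y : topologicalType) (f : X -> Y) :=
  continuous f /\
  exists g : Y -> X, [/\ cancel f g, cancel g f & continuous g].

Record Z2_MPS (R : realType) := {
  mps_space :> pointedMetricType R;
  mps_compact : compact [set: mps_space];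
  mps_mu : probability (Borel mps_space) R;
  mps_act : int * int -> mps_space -> mps_space;
  mps_homeo : forall w, homeomorphism (mps_act w);
  mps_actD : forall w u, mps_act w \o mps_act u = mps_act (w + u);
  mps_act0 : mps_act 0 = id;
  mps_inv : forall w (B : set (Borel mps_space)), measurable B ->
    mps_mu (mps_act w @^-1` B) = mps_mu B
}.

Section Kronecker.
Context (R : realType) (S : Z2_MPS R).
Local Notation X := (Borel S).
Local Notation mu := (mps_mu S).
Local Notation T := (@mps_act R S).

Definition L2 := LspaceType mu (lee1n 2).

Lemma act_measurable w : measurable_fun [set: X] (T w : X -> X).
Proof.
apply: (@measurability _ _ X X setT (T w) (@open S)) => // _ [B oB <-].
rewrite setTI; apply: sub_sigma_algebra.
by have [/continuousP cT _] := mps_homeo S w; exact: cT.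
Qed.

Lemma measurable_sqnorm (f : X -> R) : measurable_fun [set: X] f ->
  measurable_fun [set: X] (fun x => `|(f x)%:E| `^ 2%:R)%E.
Proof.
move=> mf; apply: (measurableT_comp (measurable_poweR _)) => //.
by apply: measurableT_comp => //; exact/measurable_EFinP.
Qed.

Lemma integral_act w (f : X -> \bar R) : measurable_fun [set: X] f ->
  (forall x, 0 <= f x)%E -> (\int[mu]_x f (T w x) = \int[mu]_x f x)%E.
Proof.
move=> mf f0.
have := @ge0_integral_pushforward _ _ X X R (T w) (act_measurable w) mu
  setT f measurableT mf (fun y _ => f0 y).
rewrite preimage_setT => <-.
apply: eq_measure_integral => [|mT B mB _]; first exact: act_measurable.
exact: mps_inv.
Qed.

Lemma Lfun_act w (f : X -> R) :
  f \in Lfun mu 2%:R%:E -> (f \o T w) \in Lfun mu 2%:R%:E.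
Proof.
move=> /andP[/[!inE]/= mf]; rewrite /finite_norm => Nf.
apply/andP; split; rewrite inE /=.
  by apply: (measurableT_comp mf); exact: act_measurable.
rewrite /finite_norm; move: Nf; rewrite unlock /Lnorm /=.
rewrite -(integral_act w (measurable_sqnorm mf)) // => x.
exact: poweR_ge0.
Qed.

Definition koopman (w : int * int) (f : L2) : L2 :=
  Lclass (lee1n 2) (Lfun_act w (Lspace_Lfun f)).

(* koopman is defined through the representative chosen by the library; the
   result does not depend on that choice. *)
Lemma koopmanE w (f : X -> R) (Lf : f \in Lfun mu 2%:R%:E) :
  koopman w (Lclass (lee1n 2) Lf) = Lclass (lee1n 2) (Lfun_act w Lf).
Proof.
apply: Lspace_eq.
apply: (ae_eq_trans (LclassE _ _)); apply: ae_eq_sym.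
apply: (ae_eq_trans (LclassE _ _)); apply: ae_eq_sym.
have [N [mN N0 fN]] := LclassE (lee1n 2) Lf.
exists (T w @^-1` N); split.
- by rewrite -[X in measurable X]setTI; exact: act_measurable.
- by rewrite -N0; exact: mps_inv.
- move=> x /= fx; apply: fN => /= fTx; exact: fx.
Qed.

Lemma Lfun_indic (B : set X) :
  measurable B -> (\1_B : X -> R) \in Lfun mu 2%:R%:E.
Proof.
move=> mB; apply/andP; split; rewrite inE /=; first exact: measurable_indic.
rewrite /finite_norm unlock /Lnorm; apply: poweR_lty.
apply: (@le_lt_trans _ _ (\int[mu]_x (cst 1 x))%E); last first.
  rewrite integral_cst// mul1e; apply: le_lt_trans (ltry 1).
  by rewrite (probability_le1 mu).
apply: ge0_le_integral => //.
- by move=> x _; exact: poweR_ge0.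
- by apply: measurable_sqnorm; exact: measurable_indic.
- move=> x _ /=; rewrite indicE; case: (x \in B) => /=.
    by rewrite normr1 powR1.
  by rewrite normr0 powR0 ?lee_fin// pnatr_eq0.
Qed.

Definition indicL2 (B : set X) (mB : measurable B) : L2 :=
  Lclass (lee1n 2) (Lfun_indic mB).

(* The lattice points within vertical distance b / 2 of the line directed by
   (1, beta). *)
Definition strip (beta b : R) : set (int * int) :=
  [set w | beta * w.1%:~R - b / 2 <= w.2%:~R <= beta * w.1%:~R + b / 2].

Definition Kronecker_along (A : set (int * int)) : set (set X) :=
  [set B | exists mB : measurable B,
     compact (closure [set koopman w (indicL2 mB) | w in A])].

Definition directional_Kronecker (beta b : R) := Kronecker_along (strip beta b).

Definition Kronecker := Kronecker_along [set: int * int].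

Definition directional_discrete_spectrum (beta b : R) :=
  directional_Kronecker beta b = measurable.

Definition discrete_spectrum := Kronecker = measurable.

End Kronecker.

(* Main.v *)
Require Import Defs.
From HB Require Import structures.
From mathcomp Require Import all_boot all_order all_algebra.
From mathcomp Require Import all_classical all_reals all_analysis.
From mathcomp Require Import measurable_realfun lra.

Set Implicit Arguments.
Unset Strict Implicit.
Unset Printing Implicit Defensive.
Import Order.TTheory GRing.Theory Num.Theory.
Import numFieldNormedType.Exports.
Local Open Scope classical_set_scope.
Local Open Scope ring_scope.

(** If the whole orbit of every indicator is relatively compact, so is any part
of it, which gives the implication from discrete spectrum to directional
discrete spectrum for all directions.

For the converse, relative compactness of an orbit along a set [A] of lattice
points is read through ultrafilters: it holds exactly when [koopman w f]
converges as [w] runs along any ultrafilter on the lattice containing [A]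
([compact_closure_imageP]), because metric spaces are regular.

The strips of width [b] around two distinct directions may be too thin for
their sum to be the whole lattice, so they are first widened.  Along an
ultrafilter containing a wide strip, the vertical offset to the line stays in a
segment and therefore converges; hence the ultrafilter, translated by a single
lattice point [w0], contains the thin strip ([strip_ultra_translate]).  The
translation by [w0] turns the indicator of [B] into the indicator of another
measurable set, for which convergence along the thin strip is again known.  This
is where the hypothesis on all measurable sets is used for the first time.

For wide enough strips every lattice point is a sum [u + v] of a point of each
strip ([strip_decomposition]): move along the first direction to the abscissa
where the two lines through [0] and [w] meet, and round.  Along an ultrafilter,
[koopman v 1_B] converges to some [g].  A limit of indicators is an indicator
([lim_indic_indic]), so [koopman u g] converges as well, to some [l].
The Koopman operators being contractions, [koopman (u + v) 1_B], which is
[koopman u (koopman v 1_B)], has the same limit [l] ([ultra_cvg_sum]). *)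

(** * Relative compactness through ultrafilters *)

Lemma proper_meet I (F : set_system I) (A B : set I) :
  ProperFilter F -> F A -> F B -> exists x, A x /\ B x.
Proof.
by move=> PF FA FB; apply: (@filter_ex _ F _ (A `&` B)); exact: filterI.
Qed.

Lemma fmap_ultra I J (f : I -> J) (G : set_system I) :
  UltraFilter G -> UltraFilter (f @ G).
Proof.
move=> UG; split=> [|H PH sGH]; first exact: fmap_proper_filter.
apply/seteqP; split=> [A HA|A]; last exact: sGH.
have [//|GnA] := in_ultra_setVsetC (f @^-1` A) UG.
have HnA : H (~` A) by apply: sGH.
by have [x []] := proper_meet PH HA HnA.
Qed.

Definition ultra_cvg_on I (M : topologicalType) (A : set I) (f : I -> M) :=
  forall G : set_system I, UltraFilter G -> G A -> exists l : M, f @ G --> l.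

(** For the converse part, a filter [F] on the closure of the image is not pulled
back itself, since its members may miss the image.  Its open members do meet the
image, and their preimages generate a filter on [I]; a limit [l] of [f] along an
ultrafilter refining it is a cluster point of [F], because in a regular space a
closed neighbourhood of [l] avoided by a member of [F] would be avoided by an
open one. *)
Lemma compact_closure_imageP I (M : topologicalType) (A : set I) (f : I -> M) :
  regular_space M -> compact (closure (f @` A)) <-> ultra_cvg_on A f.
Proof.
move=> regM; split=> [cA G UG GA|ucvg F PF FA].
  move: cA; rewrite compact_ultra => /(_ _ (fmap_ultra f UG)) [].
    by apply: (@filterS _ G _ A) => // w Aw; apply: subset_closure; exists w.
  by move=> l [_ fGl]; exists l.
pose H : set_system I :=
  filter_from [set V : set M | open V /\ F V] (fun V => A `&` f @^-1` V).
have PH : ProperFilter H.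
  apply: filter_from_proper; last first.
    move=> V [oV FV]; have [x [Vx clx]] := proper_meet PF FV FA.
    have [|_ [[w Aw <-] Vw]] := clx V; first exact: open_nbhs_nbhs.
    by exists w.
  apply: filter_from_filter.
    by exists setT; split; [exact: openT|exact: filterT].
  move=> V W [oV FV] [oW FW]; exists (V `&` W).
    by split; [exact: openI|exact: filterI].
  by move=> w [Aw [Vw Ww]].
have [G [UG sHG]] := ultraFilterLemma PH.
have GA : G A.
  by apply: sHG; exists setT => [|w []//]; split; [exact: openT|exact: filterT].
have [l fGl] := ucvg G UG GA.
exists l; split.
  move=> N /fGl GN; have [w [Aw Nw]] := @proper_meet _ G A (f @^-1` N) _ GA GN.
  by exists (f w); split => //; exists w.
move=> B N FB /regM[N' N'l sN'N].
apply: contrapT => /set0P/negP; rewrite negbK => /eqP BN0.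
(* B misses the closed set closure N', so F has an open member missing it. *)
have FnN' : F (~` closure N').
  by apply: filterS FB => x Bx /sN'N Nx; rewrite -[False]/(set0 x) -BN0.
have GnN' : G (f @^-1` ~` closure N').
  apply: sHG; exists (~` closure N'); last by move=> w [].
  by split => //; apply: closed_openC; exact: closed_closure.
have [w [nN' N'w]] := @proper_meet _ G _ (f @^-1` N') _ GnN' (fGl _ N'l).
by apply: nN'; exact: subset_closure.
Qed.

(** * Strips of the lattice *)

Section strip.
Variable R : realType.
Implicit Types (beta b : R).

(** The signed vertical distance from the line directed by (1, beta): it is
additive in the lattice point, and strips are its sublevel sets. *)
Definition offset beta (w : int * int) : R := w.2%:~R - beta * w.1%:~R.

Lemma offsetB beta w u : offset beta (w - u) = offset beta w - offset beta u.
Proof. by rewrite /offset /= !rmorphB /=; lra. Qed.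

Lemma stripE beta b w : strip beta b w <-> `|offset beta w| <= b / 2.
Proof.
rewrite /strip /offset /= ler_distl; split=> /andP[h1 h2]; apply/andP; split; lra.
Qed.

(** The offset is bounded on the wide strip, so it converges along [G]; any [w0]
whose offset is within b / 4 of the limit will do. *)
Lemma strip_ultra_translate beta b b' (G : set_system (int * int)) :
  0 < b -> UltraFilter G -> G (strip beta b') ->
  exists w0, G [set w | strip beta b (w - w0)].
Proof.
move=> b0 UG Gb'.
have [] : (`[- (b' / 2), b' / 2]%classic `&` [set y | offset beta @ G --> y]) !=set0.
  have := @segment_compact R (- (b' / 2)) (b' / 2); rewrite compact_ultra.
  move=> /(_ _ (fmap_ultra (offset beta) UG)); apply.
  apply: (@filterS _ G _ (strip beta b')) => // w /stripE.
  by rewrite ler_norml /= in_itv.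
move=> y [_ Gy].
have b4 : 0 < b / 4 by lra.
have Gyb : G [set w | `|y - offset beta w| < b / 4].
  have /cvgrPdist_lt h : offset beta @ G --> y by [].
  exact: h.
have [w0 w0y] := filter_ex Gyb; exists w0.
apply: filterS Gyb => w wy; apply/stripE; rewrite offsetB.
move: w0y wy; rewrite /= !ltr_norml ler_norml => /andP[? ?] /andP[? ?].
apply/andP; split; lra.
Qed.

(** Over the reals, [w] splits exactly along the two lines, the first component
having abscissa [x].  Rounding [x] costs an offset at most |beta1 - beta2| and
rounding the ordinate costs at most 1, whence the width. *)
Lemma strip_decomposition beta1 beta2 : beta1 <> beta2 ->
  exists b', forall w, exists u v,
    [/\ w = u + v, strip beta1 b' u & strip beta2 b' v].
Proof.
move=> /eqP; rewrite -subr_eq0 => d0.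
exists (2 * (`|beta1 - beta2| + 1)) => -[p q].
pose x : R := (q%:~R - beta2 * p%:~R) / (beta1 - beta2).
pose t := Num.floor x; pose n := Num.floor (beta1 * t%:~R).
have xE : q%:~R - beta2 * p%:~R = x * (beta1 - beta2) by rewrite divfK.
have /andP[t1 t2] := floor_itv x; have /andP[n1 n2] := floor_itv (beta1 * t%:~R).
rewrite -/t in t1 t2; rewrite -/n in n1 n2.
rewrite intrD in t2; rewrite intrD in n2.
exists (t, n), (p - t, q - n); split.
- by congr pair; rewrite /= addrC subrK.
- apply/stripE; rewrite /offset /= [2 * _]mulrC mulfK// ler_norml.
  have := normr_ge0 (beta1 - beta2).
  by move=> ?; apply/andP; split; lra.
- apply/stripE; rewrite /offset /= [2 * _]mulrC mulfK// !rmorphB /=.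
  have -> : q%:~R - n%:~R - beta2 * (p%:~R - t%:~R) =
     (x - t%:~R) * (beta1 - beta2) + (beta1 * t%:~R - n%:~R).
    by move: xE; lra.
  apply: (le_trans (ler_normD _ _)); apply: lerD.
    rewrite normrM ler_piMl// ger0_norm; lra.
  rewrite ger0_norm; lra.
Qed.
End strip.

(** * Koopman operators on indicators *)

Lemma le_Lnorm d (T : measurableType d) (R : realType)
    (mu : {measure set T -> \bar R}) (r : R) (u v : T -> R) :
  0 <= r ->
  measurable_fun [set: T] u -> measurable_fun [set: T] v ->
  {ae mu, forall x, `|u x| <= `|v x|} ->
  ('N[mu]_r%:E[EFin \o u] <= 'N[mu]_r%:E[EFin \o v])%E.
Proof.
have mpow (g : T -> R) : measurable_fun [set: T] g ->
    measurable_fun [set: T] (fun x => `|(EFin \o g) x| `^ r)%E.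
  move=> mg; apply: (measurableT_comp (measurable_poweR _)) => //.
  by apply: measurableT_comp => //; exact/measurable_EFinP.
move=> r0 mu_ mv uv; rewrite unlock /Lnorm.
have mono (s : R) (x y : \bar R) : 0 <= s -> (0 <= x <= y)%E ->
    (x `^ s <= y `^ s)%E.
  move=> s0 /andP[x0 xy].
  by apply: gt0_ler_poweR => //; rewrite in_itv/= leey andbT ?(le_trans x0).
apply: (mono); rewrite ?invr_ge0//; apply/andP; split.
  by apply: integral_ge0 => x _; exact: poweR_ge0.
apply: ae_ge0_le_integral => //; try exact: mpow.
- by move=> x _; exact: poweR_ge0.
- by move=> x _; exact: poweR_ge0.
- by apply: filterS uv => x uvx _; apply: mono => //; rewrite abse_ge0/= lee_fin.
Qed.

Section koopman.
Context (R : realType) (S : Z2_MPS R).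
Local Notation X := (Borel S).
Local Notation mu := (mps_mu S).
Local Notation T := (@mps_act R S).

Lemma act_preimage_measurable w (B : set X) :
  measurable B -> measurable (T w @^-1` B : set X).
Proof. by move=> mB; rewrite -[X in measurable X]setTI; exact: act_measurable. Qed.

Lemma eq_indicL2 (B C : set X) (mB : measurable B) (mC : measurable C) :
  B = C -> indicL2 mB = indicL2 mC.
Proof. by move=> BC; subst C; rewrite (Prop_irrelevance mB mC). Qed.

Lemma koopman_indic w (B : set X) (mB : measurable B) :
  koopman w (indicL2 mB) = indicL2 (act_preimage_measurable w mB).
Proof.
rewrite /indicL2 koopmanE; apply: Lspace_eq.
apply: (ae_eq_trans (LclassE _ _)); apply: ae_eq_sym.
exact: LclassE.
Qed.

Lemma koopmanD w u (B : set X) (mB : measurable B) :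
  koopman w (koopman u (indicL2 mB)) = koopman (w + u) (indicL2 mB).
Proof.
rewrite !koopman_indic; apply: eq_indicL2.
by rewrite addrC -mps_actD.
Qed.

Lemma koopmanE_ae w (f : L2 S) :
  ae_eq mu setT (koopman w f : X -> R) ((f : X -> R) \o T w).
Proof. exact: LclassE. Qed.

Lemma le_mdist_koopman w (f g : L2 S) :
  mdist (koopman w f) (koopman w g) <= mdist f g.
Proof.
rewrite -lee_fin [leLHS]Ldist_EFin [leRHS]Ldist_EFin.
pose h : X -> R := (f : X -> R) \- (g : X -> R).
have mh : measurable_fun setT h by apply: measurable_funB; exact: Lspace_mfun.
apply: (@le_trans _ _ ('N[mu]_2%:R%:E[EFin \o (h \o T w)])%E).
  apply: le_Lnorm => //.
  - by apply: measurable_funB; exact: Lspace_mfun.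
  - by apply: (measurableT_comp mh); exact: act_measurable.
  - apply: filterS2 (koopmanE_ae w f) (koopmanE_ae w g) => x /= fx gx.
    by rewrite fx// gx.
rewrite unlock /Lnorm -(integral_act w (measurable_sqnorm mh)) // => x.
exact: poweR_ge0.
Qed.

(** The indicator of [C = {g > 1/2}] is a best approximation of [g] among the
functions with values in {0, 1}, pointwise.  So it is at least as close to [g]
as each indicator of the family, hence at distance zero. *)
Lemma lim_indic_indic I (G : set_system I) (B : I -> set X)
    (mB : forall i, measurable (B i)) (g : L2 S) : ProperFilter G ->
  (fun i => indicL2 (mB i)) @ G --> g ->
  exists (C : set X) (mC : measurable C), g = indicL2 mC.
Proof.
move=> PG Bg; have mg := Lspace_mfun g.
pose C : set X := [set x | 2^-1 < (g : X -> R) x].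
have mC : measurable C.
  have := mg measurableT `]2^-1, +oo[%classic (measurable_itv _).
  rewrite setTI; congr measurable; apply/seteqP.
  by split=> x; rewrite /= in_itv/= andbT.
exists C, mC; apply: mdist_positivity; apply/eqP; rewrite eq_le mdist_ge0 andbT.
apply/ler_addgt0Pl => e e0; rewrite addr0.
have [i Bi] : exists i, mdist g (indicL2 (mB i)) < e.
  apply: (@filter_ex _ G).
  by move/metricType_numDomainType.cvgrPdist_lt: Bg; exact.
apply: le_trans (ltW Bi).
rewrite -lee_fin [leLHS]Ldist_EFin [leRHS]Ldist_EFin.
apply: le_Lnorm => //; try by apply: measurable_funB; exact: Lspace_mfun.
apply: filterS2 (LclassE (lee1n 2) (Lfun_indic mC))
  (LclassE (lee1n 2) (Lfun_indic (mB i))) => x /= Cx Bx.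
rewrite Cx// Bx// !indicE.
have [xC|xC] := boolP (x \in C).
  have {}xC : 2^-1 < (g : X -> R) x by rewrite inE in xC.
  case: (x \in B i) => //=; rewrite subr0 [leRHS]ger0_norm ?ler_norml; last lra.
  by apply/andP; split; lra.
have {}xC : (g : X -> R) x <= 2^-1.
  by rewrite leNgt; apply: contra xC; rewrite inE.
case: (x \in B i) => //=; rewrite subr0 [leRHS]ler0_norm ?ler_norml; last lra.
by apply/andP; split; lra.
Qed.

(** Quantifying over all measurable sets makes the property stable under the two
operations needed below: replacing an indicator by one of its translates, and
by an L2-limit of its translates. *)
Definition indic_ultra_cvg (A : set (int * int)) :=
  forall (B : set X) (mB : measurable B),
    ultra_cvg_on A (fun w => koopman w (indicL2 mB)).
Arguments indic_ultra_cvg : clear implicits.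

Lemma Kronecker_along_measurableP A :
  @Kronecker_along R S A = measurable <-> indic_ultra_cvg A.
Proof.
split=> [KA B mB|cA].
  have [mB' cB] : Kronecker_along A B by rewrite KA.
  apply/compact_closure_imageP; first exact: uniform_regular.
  by rewrite (Prop_irrelevance mB mB').
apply/seteqP; split=> B; first by case.
move=> mB; exists mB.
by apply/compact_closure_imageP; [exact: uniform_regular|exact: cA].
Qed.

(** [koopman w 1_B] is [koopman (w - w0)] applied to the indicator of the
preimage of [B] under the action of [w0]. *)
Lemma strip_ultra_cvg_widen (beta b b' : R) : 0 < b ->
  indic_ultra_cvg (strip beta b) -> indic_ultra_cvg (strip beta b').
Proof.
move=> b0 cA B mB G UG GA.
have [w0 Gw0] := strip_ultra_translate b0 UG GA.
have [||l] := cA _ (act_preimage_measurable w0 mB) ((fun w => w - w0) @ G).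
- exact: fmap_ultra.
- exact: Gw0.
rewrite -fmap_comp => Gl; exists l; apply: cvg_trans Gl.
apply: near_eq_cvg; near=> w => /=.
by rewrite -koopman_indic koopmanD subrK.
Unshelve. all: end_near. Qed.

(** With sequences, one would extract a subsequence along which [koopman v 1_B]
converges to some [g], then a further one along which [koopman u g] converges;
along an ultrafilter both limits exist at once.  Convergence along [A1] is
available for [g] because [g] is again an indicator. *)
Lemma ultra_cvg_sum A1 A2 A :
  (forall w, A w -> exists u v, [/\ w = u + v, A1 u & A2 v]) ->
  indic_ultra_cvg A1 -> indic_ultra_cvg A2 -> indic_ultra_cvg A.
Proof.
move=> A12 cA1 cA2 B mB G UG GA.
have /choice[uv uvP] : forall w, exists uv : (int * int) * (int * int),
    A w -> [/\ w = uv.1 + uv.2, A1 uv.1 & A2 uv.2].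
  move=> w; have [/A12[u [v h]]|nA] := pselect (A w); first by exists (u, v).
  by exists (0, 0).
pose u w := (uv w).1; pose v w := (uv w).2.
have [||g Gg] := cA2 B mB (v @ G).
- exact: fmap_ultra.
- by apply: (@filterS _ G _ A) GA => w /uvP[].
have [C [mC gC]] : exists (C : set X) (mC : measurable C), g = indicL2 mC.
  apply: (@lim_indic_indic _ (v @ G)
    (fun w => T w @^-1` B) (fun w => act_preimage_measurable w mB)).
  have <- : (fun w => koopman w (indicL2 mB)) =
      fun w => indicL2 (act_preimage_measurable w mB).
    by apply/funext => w; exact: koopman_indic.
  exact: Gg.
have [||l Gl] := cA1 C mC (u @ G).
- exact: fmap_ultra.
- by apply: (@filterS _ G _ A) GA => w /uvP[].
exists l; apply/metricType_numDomainType.cvgrPdist_lt => e e0.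
have e2 : 0 < e / 2 by rewrite divr_gt0.
have G1 : \forall w \near G, mdist g (koopman (v w) (indicL2 mB)) < e / 2.
  by move/metricType_numDomainType.cvgrPdist_lt: Gg; exact.
have G2 : \forall w \near G, mdist l (koopman (u w) (indicL2 mC)) < e / 2.
  by move/metricType_numDomainType.cvgrPdist_lt: Gl; exact.
(* l is close to koopman u g, which is close to koopman u (koopman v 1_B). *)
near=> w.
have [|wuv _ _] := uvP w; first by near: w.
rewrite [e]splitr wuv -koopmanD.
apply: le_lt_trans (metric_triangle _ (koopman (u w) g) _) _.
apply: ltrD; first by rewrite gC; near: w.
apply: le_lt_trans (le_mdist_koopman _ _ _) _; by near: w.
Unshelve. all: end_near. Qed.

End koopman.
Arguments indic_ultra_cvg {R} S A.

Local Close Scope classical_set_scope.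

Theorem theorem1p6 (R : realType) (S : Z2_MPS R) (b : R) (b_gt0 : 0 < b) :
  (exists beta1 beta2 : R,
     [/\ beta1 <> beta2,
         directional_discrete_spectrum S beta1 b
       & directional_discrete_spectrum S beta2 b])
  <-> discrete_spectrum S.
Proof.
rewrite /discrete_spectrum /Kronecker Kronecker_along_measurableP.
split=> [[beta1 [beta2 []]]|cT].
  move=> b12 /Kronecker_along_measurableP c1 /Kronecker_along_measurableP c2.
  have [b' b'P] := strip_decomposition b12.
  apply: (@ultra_cvg_sum _ _ (strip beta1 b') (strip beta2 b')) => //.
  - exact: strip_ultra_cvg_widen c1.
  - exact: strip_ultra_cvg_widen c2.
have cstrip beta : indic_ultra_cvg S (strip beta b).
  by move=> B mB G UG _; apply: cT; exact: filterT.
exists 0, 1; split; [|exact/Kronecker_along_measurableP..].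
by apply/eqP; rewrite eq_sym oner_eq0.
Qed.
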